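(* Let $\vartheta$ be a non-degenerate, compatible, primitive, recognisable random substitution on a finite alphabet $\mathcal A$. Then the automorphism group $\operatorname{Aut}(X_2)$ of the full shift $X_2=\{0,1\}^{\mathbb Z}$ embeds (as a subgroup, via an injective group homomorphism) into $\operatorname{Aut}(X_\vartheta)$.
   Context: A random substitution on a finite alphabet $\mathcal A$ is a map $\vartheta$ from $\mathcal A$ to the non-empty finite subsets of $\mathcal A^+$ (non-empty finite words), extended to words by $\vartheta(u_0\cdots u_n)=\vartheta(u_0)\cdots\vartheta(u_n)$ (all concatenations of choices), to sets by unions, and iterated. A word is legal if it is a subword of some word in $\vartheta^p(a)$, $a\in\mathcal A$, $p\ge0$. $X_\vartheta\subseteq\mathcal A^{\mathbb Z}$ is the set of sequences all of whose finite subwords are legal, with the shift $\sigma(x)_i=x_{i+1}$; $\operatorname{Aut}(X)$ denotes the group of shift-commuting homeomorphisms of a subshift $X$. For $y\in\mathcal A^{\mathbb Z}$, $\vartheta(y)$ is the set of sequences $\cdots w_{-1}w_0w_1\cdots$ with $w_i\in\vartheta(y_i)$ and $w_0$ starting at index 0. $\vartheta$ is non-degenerate if $\#\vartheta(a)\ge2$ for some $a$; compatible if for each $a$ all words in $\vartheta(a)$ have the same number of occurrences of each letter; primitive if there is $p\ge1$ such that every letter $a$ occurs in some word of $\vartheta^p(b)$ for every $b\in\mathcal A$. A compatible $\vartheta$ is recognisable if for every $x\in X_\vartheta$ there exist a unique $y\in X_\vartheta$ and a unique $0\le k\le |\vartheta(y_0)|-1$ with $\sigma^{-k}(x)\in\vartheta(y)$.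 *)

(* Defs.v *)
From mathcomp Require Import all_boot all_order all_algebra.
Set Implicit Arguments. Unset Strict Implicit. Unset Printing Implicit Defensive.
Import GRing.Theory Num.Theory.

Definition bseq (A : Type) := int -> A.

Definition shift (A : Type) (x : bseq A) : bseq A := fun i => x (i + 1)%R.

(* A random substitution: each letter is sent to a finite list of words
   (a representation of a finite set of words). *)
Definition rsubst (A : finType) := A -> seq (seq A).

Definition rsubst_wf (A : finType) (th : rsubst A) : Prop :=
  forall a : A, th a != [::] /\ all (fun w => w != [::]) (th a).

Definition rs_word (A : finType) (th : rsubst A) (u : seq A) : seq (seq A) :=
  foldr (fun a acc => [seq v ++ w | v <- th a, w <- acc]) [:: [::]] u.

Definition rs_set (A : finType) (th : rsubst A) (S : seq (seq A)) : seq (seq A) :=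
  flatten [seq rs_word th u | u <- S].

Definition rs_pow (A : finType) (th : rsubst A) (p : nat) (a : A) : seq (seq A) :=
  iter p (rs_set th) [:: [:: a]].

Definition legal (A : finType) (th : rsubst A) (u : seq A) : Prop :=
  exists (a : A) (p : nat) (v : seq A), v \in rs_pow th p a /\ infix u v.

Definition window (A : Type) (x : bseq A) (i : int) (n : nat) : seq A :=
  [seq x (i + (Posz k))%R | k <- iota 0 n].

Definition X_rs (A : finType) (th : rsubst A) (x : bseq A) : Prop :=
  forall (i : int) (n : nat), legal th (window x i n).

Definition non_degenerate (A : finType) (th : rsubst A) : Prop :=
  exists a : A, (2 <= size (undup (th a)))%N.

Definition compatible (A : finType) (th : rsubst A) : Prop :=
  forall (a : A) (u v : seq A), u \in th a -> v \in th a ->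
    forall b : A, count_mem b u = count_mem b v.

Definition primitive (A : finType) (th : rsubst A) : Prop :=
  exists p : nat, (1 <= p)%N /\
    forall a b : A, exists2 w, w \in rs_pow th p b & a \in w.

(* Starting position of the block w_i in the concatenation ... w_{-1} w_0 w_1 ...
   with w_0 starting at index 0. *)
Definition block_pos (A : Type) (w : int -> seq A) (i : int) : int :=
  match i with
  | Posz n => Posz (\sum_(k < n) size (w (Posz k)))%N
  | Negz n => (- (Posz (\sum_(k < n.+1) size (w (- (Posz k.+1))%R))%N))%R
  end.

Definition in_rs_seq (A : finType) (th : rsubst A) (y z : bseq A) : Prop :=
  exists w : int -> seq A,
    (forall i : int, w i \in th (y i)) /\
    (forall (i : int) (j : nat), (j < size (w i))%N ->
        z (block_pos w i + Posz j)%R = nth (z 0%R) (w i) j).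

(* |theta(a)|: common length of the words in theta(a) (well defined when compatible). *)
Definition rs_len (A : finType) (th : rsubst A) (a : A) : nat :=
  size (head [::] (th a)).

Definition shift_back (A : Type) (k : nat) (x : bseq A) : bseq A :=
  fun i => x (i - Posz k)%R.

Definition recognisable (A : finType) (th : rsubst A) : Prop :=
  forall x : bseq A, X_rs th x ->
    exists (y : bseq A) (k : nat),
      [/\ X_rs th y, (k <= (rs_len th (y 0%R)).-1)%N
        & in_rs_seq th y (shift_back k x)] /\
      forall (y' : bseq A) (k' : nat),
        [/\ X_rs th y', (k' <= (rs_len th (y' 0%R)).-1)%N
          & in_rs_seq th y' (shift_back k' x)] ->
        (forall i, y' i = y i) /\ k' = k.

(* Topology of A^Z (product of discrete spaces): continuity of a map on a
   subset X, stated with cylinder neighbourhoods [-m, m]. *)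
Definition agree_on (A : Type) (m : nat) (x y : bseq A) : Prop :=
  forall i : int, (`|i| <= m)%N -> x i = y i.

Definition cont_on (A B : Type) (X : bseq A -> Prop) (F : bseq A -> bseq B) : Prop :=
  forall x : bseq A, X x -> forall n : nat, exists m : nat,
    forall y : bseq A, X y -> agree_on m x y -> agree_on n (F x) (F y).

Definition shift_comm_on (A : Type) (X : bseq A -> Prop) (F : bseq A -> bseq A) : Prop :=
  forall x, X x -> forall i, F (shift x) i = shift (F x) i.

Definition maps_into (A : Type) (X : bseq A -> Prop) (F : bseq A -> bseq A) : Prop :=
  forall x, X x -> X (F x).

Definition is_aut (A : Type) (X : bseq A -> Prop) (F : bseq A -> bseq A) : Prop :=
  [/\ maps_into X F, cont_on X F, shift_comm_on X F &
    exists G : bseq A -> bseq A,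
      [/\ maps_into X G, cont_on X G,
          (forall x, X x -> forall i, G (F x) i = x i) &
          (forall x, X x -> forall i, F (G x) i = x i)]].

Definition eq_on (A : Type) (X : bseq A -> Prop) (F G : bseq A -> bseq A) : Prop :=
  forall x, X x -> forall i, F x i = G x i.

Definition full_shift (x : bseq bool) : Prop := True.

Definition aut_embeds (B A : Type) (Y : bseq B -> Prop) (X : bseq A -> Prop) : Prop :=
  exists Phi : (bseq B -> bseq B) -> (bseq A -> bseq A),
    [/\ (forall F, is_aut Y F -> is_aut X (Phi F)),
        (forall F G, is_aut Y F -> is_aut Y G -> eq_on Y F G -> eq_on X (Phi F) (Phi G)),
        (forall F G, is_aut Y F -> is_aut Y G ->
           eq_on X (Phi (fun x => F (G x))) (fun x => Phi F (Phi G x))) &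
        (forall F G, is_aut Y F -> is_aut Y G -> eq_on X (Phi F) (Phi G) -> eq_on Y F G)].

(* Main.v *)
(* By recognisability and compatibility, a point [x] of [X_rs th] amounts to a
   point [y] of [X_rs th], a starting position, and an arbitrary choice of an image
   of each letter of [y]; changing images while keeping [y] stays inside [X_rs th].
   Let [u], [v] be distinct images of a letter [a], and call an image equal to [u]
   or [v] a bit.  Since [X_rs th] contains non-periodic points, there are a legal
   word [s] and [r] such that [s] has the letter [a] at positions 0 and [r] and no
   two occurrences of [s] are at distance [r].  An occurrence of [s] in [y] both of
   whose letters [a] carry bits is a cell, with one bit on a top and one on a bottom
   track.  Cells at distance at most [D] are chained; the two tracks of a maximal
   chain are closed up at its ends into a conveyor belt (a cycle, or one or two
   bi-infinite lines), on which an automorphism of the full 2-shift acts.  Cells do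
   not change under this action, so it is a homomorphism.  It is injective because
   some [y] contains [s] syndetically, so that any binary sequence can be written on
   the top track. *)
From mathcomp Require Import all_boot all_order all_algebra.
From mathcomp Require Import zify.
From Stdlib Require Import Classical ClassicalChoice ClassicalEpsilon FunctionalExtensionality.
(* After MathComp, whose own [bseq] would otherwise hide that of [Defs]. *)
Require Import Defs.

Set Implicit Arguments.
Unset Strict Implicit.
Unset Printing Implicit Defensive.

Import Order.TTheory GRing.Theory Num.Theory.

(** * Words *)

Section Words.

Variables (A : finType) (th : rsubst A).

Lemma rs_word_catP (u1 u2 v : seq A) :
  reflect (exists v1 v2, [/\ v1 \in rs_word th u1, v2 \in rs_word th u2 & v = v1 ++ v2])
          (v \in rs_word th (u1 ++ u2)).
Proof.
apply: (iffP idP); elim: u1 v => [|a u1 IH] v /=.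
- by move=> Hv; exists [::], v; split=> //; rewrite inE.
- case/allpairsP=> -[v0 v'] /= [Hv0 /IH [v1 [v2 [H1 H2 ->]]] ->].
  exists (v0 ++ v1), v2; split=> //; last by rewrite catA.
  by apply/allpairsP; exists (v0, v1).
- by case=> v1 [v2 [+ Hv ->]]; rewrite inE => /eqP ->.
- case=> v1 [v2 [/allpairsP [[v0 v1'] /= [H0 H1 ->]] Hv ->]].
  apply/allpairsP; exists (v0, v1' ++ v2); split=> //=; last by rewrite catA.
  by apply: IH; exists v1', v2.
Qed.

Lemma rs_word1 (a : A) (v : seq A) : (v \in rs_word th [:: a]) = (v \in th a).
Proof.
apply/allpairsP/idP => [[[v1 v2] /= [H1]]|Hv].
  by rewrite inE => /eqP -> ->; rewrite cats0.
by exists (v, [::]); rewrite /= cats0 inE.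
Qed.

Lemma rs_pow1 (a : A) (v : seq A) : (v \in rs_pow th 1 a) = (v \in th a).
Proof. by rewrite /rs_pow /= /rs_set [map _ _]/= [flatten _]/= cats0 rs_word1. Qed.

Lemma mem_iter_rs_setP (p : nat) (S : seq (seq A)) (v : seq A) :
  v \in iter p (rs_set th) S <-> exists2 u, u \in S & v \in iter p (rs_set th) [:: u].
Proof.
elim: p v => [|p IH] v /=.
  split=> [Hv|[u Hu]]; first by exists v; rewrite ?inE.
  by rewrite inE => /eqP ->.
split=> [/flatten_mapP [v' /IH [u Hu Hv'] Hv]|[u Hu /flatten_mapP [v' Hv' Hv]]].
  by exists u => //; apply/flatten_mapP; exists v'.
by apply/flatten_mapP; exists v' => //; apply/IH; exists u.
Qed.

Lemma mem_iter_rs_set_cat (p : nat) (u1 u2 v1 v2 : seq A) :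
  v1 \in iter p (rs_set th) [:: u1] -> v2 \in iter p (rs_set th) [:: u2] ->
  v1 ++ v2 \in iter p (rs_set th) [:: u1 ++ u2].
Proof.
elim: p v1 v2 => [|p IH] v1 v2 /=; first by rewrite !inE => /eqP -> /eqP ->.
move=> /flatten_mapP [w1 H1 H1'] /flatten_mapP [w2 H2 H2'].
apply/flatten_mapP; exists (w1 ++ w2); first exact: IH.
by apply/rs_word_catP; exists v1, v2.
Qed.

Lemma mem_iter_rs_set_map (p : nat) (I : Type) (f : I -> A) (w : I -> seq A) (s : seq I) :
  (forall i, w i \in rs_pow th p (f i)) ->
  flatten (map w s) \in iter p (rs_set th) [:: map f s].
Proof.
move=> Hw; elim: s => [|i s IH] /=.
  elim: p {Hw} => [|p IH] //=.
  by apply/flatten_mapP; exists [::].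
exact: (@mem_iter_rs_set_cat p [:: f i]).
Qed.

Lemma legal_infix (u v : seq A) : infix u v -> legal th v -> legal th u.
Proof. by move=> H [a [p [w [Hw Hv]]]]; exists a, p, w; split=> //; apply: infix_trans Hv. Qed.

Lemma legal_pow (p : nat) (a : A) (v : seq A) : v \in rs_pow th p a -> legal th v.
Proof. by exists a, p, v; rewrite infix_refl. Qed.

Hypothesis th_wf : rsubst_wf th.

Lemma iter_rs_set_nonempty (p : nat) (u : seq A) :
  exists v, v \in iter p (rs_set th) [:: u].
Proof.
elim: p => [|p [v Hv]] /=; first by exists u; rewrite inE.
have [v' Hv'] : exists v', v' \in rs_word th v.
  elim: v {Hv} => [|a v [v' Hv']]; first by exists [::]; rewrite inE.
  have [+ _] := th_wf a; case E: (th a) => [//|w l] _.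
  exists (w ++ v') => /=; apply/allpairsP; exists (w, v'); split=> //=.
  by rewrite E inE eqxx.
by exists v'; apply/flatten_mapP; exists v.
Qed.

(** The letters to the left and right of [u] in a word generated from a letter have images too, so
    the image of [u] extends to an image of that whole word. *)
Lemma legal_image (p : nat) (u v : seq A) :
  legal th u -> v \in iter p (rs_set th) [:: u] -> legal th v.
Proof.
move=> [a [q [w [Hw /infixP [l [r E]]]]]] Hv.
have [l' Hl] := iter_rs_set_nonempty p l.
have [r' Hr] := iter_rs_set_nonempty p r.
exists a, (p + q), (l' ++ v ++ r'); split; last by apply/infixP; exists l', r'.
rewrite /rs_pow iterD; apply/mem_iter_rs_setP; exists w => //; rewrite E.
by do 2! [apply: mem_iter_rs_set_cat => //].
Qed.

Lemma size_iter_rs_set (p : nat) (u v : seq A) :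
  v \in iter p (rs_set th) [:: u] -> size u <= size v.
Proof.
elim: p v => [|p IH] v /=; first by rewrite inE => /eqP ->.
move=> /flatten_mapP [w /IH Hu Hv]; apply: leq_trans Hu _.
elim: w v Hv => [//|a w IHw] v /allpairsP [[v0 v1] /= [H0 /IHw H1 ->]].
have [_ /allP /(_ _ H0)] := th_wf a.
by rewrite size_cat; case: v0 {H0} => //= *; lia.
Qed.

Hypothesis th_compat : compatible th.

Lemma compatible_perm (a : A) (u v : seq A) : u \in th a -> v \in th a -> perm_eq u v.
Proof. by move=> Hu Hv; apply/allP=> b _ /=; apply/eqP; apply: th_compat Hu Hv b. Qed.

Lemma size_rs_len (a : A) (u : seq A) : u \in th a -> size u = rs_len th a.
Proof.
move=> Hu; apply: perm_size; apply: (compatible_perm Hu).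
by case: (th a) Hu => //= v s _; rewrite inE eqxx.
Qed.

Lemma rs_len_gt0 (a : A) : 0 < rs_len th a.
Proof.
by have [+ +] := th_wf a; rewrite /rs_len; case: (th a) => //= -[].
Qed.

Hypothesis th_prim : primitive th.

(* Two distinct anagrams have length at least two, so a letter with two images
   forces growth through primitivity. *)
Lemma legal_long (a : A) (u v : seq A) (N : nat) :
  u \in th a -> v \in th a -> u != v ->
  exists2 w, legal th w & N <= size w.
Proof.
move=> Hu Hv uv.
have su : 1 < size u.
  have := compatible_perm Hu Hv; have := rs_len_gt0 a.
  rewrite -(size_rs_len Hu); case: u uv {Hu} => [|b [|c u]] // uv _ Huv.
  move: uv; have := perm_size Huv; case: v Hv Huv => [|d [|]] // _ Huv _.
  by rewrite eqseq_cons andbT; have := perm_mem Huv b; rewrite !inE eqxx => <-.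
have [p [p_gt0 Hp]] := th_prim.
(* Primitivity puts [a] in some [p]-fold image of [b], and one further substitution can turn that
   [a] into [u], of length at least two. *)
have step b : exists2 w, w \in rs_pow th p.+1 b & 1 < size w.
  have [w Hw aw] := Hp a b.
  have [v' Hv' sv'] : exists2 v', v' \in rs_word th w & 1 < size v'.
    have [l r] := path.splitPr aw.
    have [l' Hl] := iter_rs_set_nonempty 1 l.
    have [r' Hr] := iter_rs_set_nonempty 1 r.
    exists (l' ++ u ++ r'); last by rewrite !size_cat addnCA ltn_addr.
    rewrite -cat1s; apply/rs_word_catP; exists l', (u ++ r'); split=> //.
      by move: Hl => /= /flatten_mapP [? ]; rewrite inE => /eqP ->.
    apply/rs_word_catP; exists u, r'; split=> //; first by rewrite rs_word1.
    by move: Hr => /= /flatten_mapP [? ]; rewrite inE => /eqP ->.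
  by exists v' => //; rewrite /rs_pow /=; apply/flatten_mapP; exists w.
have [f Hf sf] : exists2 f : A -> seq A, (forall b, f b \in rs_pow th p.+1 b) &
    forall b, 1 < size (f b).
  have /fin_all_exists [f Hf] : forall b, exists w, w \in rs_pow th p.+1 b /\ 1 < size w.
    by move=> b; have [w] := step b; exists w.
  by exists f => b; case: (Hf b).
elim: N => [|N [w0 Hw0 sw0]]; first by exists [::] => //; exists a, 0, [:: a]; rewrite inE eqxx.
(* For [N = 0] the word at hand may be empty and would not grow, so a single letter replaces it. *)
have [w Hw [sw w_gt0]] : exists2 w, legal th w & N <= size w /\ 0 < size w.
  case: w0 Hw0 sw0 => [|b w Hw sw]; last by exists (b :: w).
  move=> _; rewrite leqn0 => /eqP ->; exists [:: a] => //.
  by apply: (@legal_pow 0 a); rewrite inE.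
exists (flatten (map f w)).
  by apply: legal_image Hw _; rewrite -[X in [:: X]]map_id; apply: (mem_iter_rs_set_map w Hf).
case: w sw w_gt0 {Hw} => //= b w sw _; rewrite size_cat.
have : size w <= size (flatten (map f w)).
  by elim: w {sw} => //= c w IH; rewrite size_cat; have := sf c; lia.
by have := sf b; lia.
Qed.

End Words.

(** * Compactness *)

(** König's argument: a prefix shared by infinitely many [f n] has a one-letter extension with the
    same property, because [T] is finite; the limit [g] is read off the chain of prefixes obtained
    in this way. *)
Lemma accumulation_nat (T : finType) (f : nat -> nat -> T) :
  exists g : nat -> T, forall l N, exists2 n, N <= n & forall j, j < l -> f n j = g j.
Proof.
pose often (p : seq T) := forall N, exists2 n, N <= n & mkseq (f n) (size p) = p.
have extend p : often p -> exists t, often (rcons p t).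
  move=> Hp; apply: NNPP => Hn.
  have /fin_all_exists [B HB] : forall t, exists B, forall n, B <= n ->
      mkseq (f n) (size p).+1 <> rcons p t.
    move=> t; apply: NNPP => H; apply: Hn; exists t => N; apply: NNPP => H'.
    apply: H; exists N => n Nn E; apply: H'; exists n => //.
    by rewrite size_rcons.
  have [n Hn' E] := Hp (\max_t B t).
  apply: (HB (f n (size p)) n (leq_trans (leq_bigmax _) Hn')).
  by rewrite mkseqS E.
pose next (p : {p | often p}) : {p | often p} :=
  let: exist q Hq := p in
  let: exist t Ht := constructive_indefinite_description _ (extend q Hq) in
  exist _ (rcons q t) Ht.
have often0 : often [::] by move=> N; exists N.
pose P n : seq T := sval (iter n next (exist _ [::] often0)).
have PS n : exists t, P n.+1 = rcons (P n) t.
  rewrite /P iterS; case: (iter n _ _) => q Hq /=.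
  by case: (constructive_indefinite_description _ _) => t Ht; exists t.
have sP n : size (P n) = n.
  by elim: n => [|n IH] //; have [t ->] := PS n; rewrite size_rcons IH.
pose g j := nth (f 0 0) (P j.+1) j.
have gP l j : j < l -> nth (f 0 0) (P l) j = g j.
  elim: l => [//|l IH]; rewrite ltnS leq_eqVlt => /orP[/eqP -> //|jl].
  by have [t ->] := PS l; rewrite nth_rcons sP jl IH.
exists g => l N.
have [n Nn E] := svalP (iter l next (exist _ [::] often0)) N.
exists n => // j jl; rewrite -(gP l) // -/(P l) in E *.
by rewrite -E nth_mkseq // sP.
Qed.

Lemma accumulation (T : finType) (f : nat -> bseq T) :
  exists g : bseq T, forall l N, exists2 n, N <= n & agree_on l (f n) g.
Proof.
pose dec (j : nat) : int := if odd j then Negz j./2 else Posz j./2.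
pose enc (i : int) : nat := match i with Posz n => n.*2 | Negz n => n.*2.+1 end.
have encK i : dec (enc i) = i.
  by case: i => n; rewrite /dec /enc /= ?odd_double ?doubleK //= uphalf_double.
have [g Hg] := accumulation_nat (fun n j => f n (dec j)).
(* The integers are enumerated as 0, -1, 1, -2, and so on, so those in [[-l, l]] have codes below
   [2l + 1]. *)
exists (fun i => g (enc i)) => l N; have [n Nn H] := Hg l.*2.+1 N.
exists n => // i il; rewrite -H ?encK //.
by move: il; rewrite /enc; case: i => m; lia.
Qed.

(** * Bi-infinite sequences *)

(** With an equivalence as induction step, one recurrence between [i] and [i + 1] serves both
    directions. *)
Lemma int_ind_shift (P : int -> Prop) :
  P 0%R -> (forall i, P i <-> P (i + 1)%R) -> forall i, P i.
Proof.
move=> P0 PS; elim=> [//|n|n] H; first by have := (PS (Posz n)).1 H; rewrite -PoszD addn1.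
by apply/(PS _); have -> : (- Posz n.+1 + 1 = - Posz n)%R by lia.
Qed.

Section Window.

Variable A : Type.
Implicit Types (x : bseq A).

Lemma size_window x i n : size (window x i n) = n.
Proof. by rewrite size_map size_iota. Qed.

Lemma nth_window d x i n j : j < n -> nth d (window x i n) j = x (i + Posz j)%R.
Proof. by move=> jn; rewrite (nth_map 0) ?size_iota // nth_iota. Qed.

Lemma eq_window x x' i i' n :
  (forall j, j < n -> x (i + Posz j)%R = x' (i' + Posz j)%R) <->
  window x i n = window x' i' n.
Proof.
split=> [H|E j jn]; last by rewrite -(nth_window (x 0%R) x i jn) E nth_window.
by apply/eq_in_map => j; rewrite mem_iota => /andP[_]; apply: H.
Qed.

Lemma window_shift x (n : int) i m : window (fun i => x (i + n)%R) i m = window x (i + n)%R m.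
Proof. by apply/eq_window => j _; congr x; lia. Qed.

Lemma window_add x i m n :
  window x i (m + n) = window x i m ++ window x (i + Posz m)%R n.
Proof.
rewrite /window iotaD map_cat add0n; congr (_ ++ _).
rewrite -{1}(addn0 m) iotaDl -map_comp; apply: eq_map => k /=.
by congr x; lia.
Qed.

End Window.

Section Bseq.

Variable A : Type.
Implicit Types (x y : bseq A) (w : bseq (seq A)).

Lemma block_pos0 w : block_pos w 0 = 0%R.
Proof. by rewrite /= big_ord0. Qed.

Lemma block_posS w i : block_pos w (i + 1)%R = (block_pos w i + Posz (size (w i)))%R.
Proof.
case: i => n; first by rewrite -PoszD addn1 /= big_ord_recr.
case: n => [|n].
  by rewrite /= big_ord0 big_ord_recr big_ord0 /= NegzE; lia.
have -> : (Negz n.+1 + 1 = Negz n)%R by lia.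
by rewrite /= [in RHS]big_ord_recr /= !NegzE; lia.
Qed.

Lemma eq_block_pos w w' i : (forall j, size (w j) = size (w' j)) ->
  block_pos w i = block_pos w' i.
Proof.
move=> E; elim/int_ind_shift: i => [|i]; first by rewrite !block_pos0.
by rewrite !block_posS E; split; lia.
Qed.

Lemma block_pos_shift w n i :
  block_pos (fun i => w (i + n)%R) i = (block_pos w (i + n) - block_pos w n)%R.
Proof.
elim/int_ind_shift: i => [|i]; first by rewrite block_pos0 add0r subrr.
rewrite block_posS (_ : i + 1 + n = i + n + 1)%R ?block_posS; last by lia.
by split; lia.
Qed.

Lemma flatten_window w i m :
  Posz (size (flatten (window w i m))) = (block_pos w (i + Posz m) - block_pos w i)%R.
Proof.
elim: m => [|m IH]; first by rewrite addr0 subrr.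
rewrite -{1}(addn1 m).
rewrite window_add flatten_cat size_cat PoszD IH /= cats0.
have -> : (i + m.+1 = i + m + 1)%R by lia.
by rewrite block_posS addr0; lia.
Qed.

Section Glued.

Variable w : bseq (seq A).
Hypothesis w_gt0 : forall i, 0 < size (w i).

Lemma block_pos_mono i j : (i <= j)%R -> (block_pos w i + (j - i) <= block_pos w j)%R.
Proof.
move=> ij; have -> : j = (i + Posz (absz (j - i)))%R by lia.
elim: (absz _) => [|n IH]; first by rewrite addr0; lia.
have -> : (i + n.+1 = i + n + 1)%R by lia.
by rewrite block_posS; have := w_gt0 (i + n)%R; lia.
Qed.

Lemma block_pos_locate (s : int) :
  exists i, (block_pos w i <= s < block_pos w (i + 1))%R.
Proof.
elim/int_ind_shift: s => [|s].
  by exists 0%R; rewrite block_posS block_pos0; have := w_gt0 0%R; lia.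
split=> -[i Hi].
  have [?|?] := boolP (s + 1 < block_pos w (i + 1))%R; first by exists i; lia.
  exists (i + 1)%R; rewrite (block_posS _ (i + 1)%R).
  by have := w_gt0 (i + 1)%R; lia.
have [?|?] := boolP (block_pos w i <= s)%R; first by exists i; lia.
exists (i - 1)%R; rewrite subrK.
have : block_pos w (i - 1 + 1)%R = block_pos w i by rewrite subrK.
by rewrite block_posS; have := w_gt0 (i - 1)%R; lia.
Qed.

Lemma block_pos_locate_uniq (s : int) i j :
  (block_pos w i <= s < block_pos w (i + 1))%R ->
  (block_pos w j <= s < block_pos w (j + 1))%R -> i = j.
Proof.
move=> Hi Hj; case: (ltrgtP i j) => // ij.
  by have := @block_pos_mono (i + 1)%R j; lia.
by have := @block_pos_mono (j + 1)%R i; lia.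
Qed.

Lemma glue (t : int) :
  exists x, forall i, window x (t + block_pos w i)%R (size (w i)) = w i.
Proof.
have [d _] : exists d : A, true by have := w_gt0 0%R; case: (w 0%R) => // d; exists d.
pose idx s := xchoose (block_pos_locate (s - t)%R).
exists (fun s => nth d (w (idx s)) (absz (s - t - block_pos w (idx s))%R)) => i.
apply: (@eq_from_nth _ d) => [|j]; rewrite size_window // => jw.
rewrite nth_window //.
have -> : idx (t + block_pos w i + j)%R = i.
  apply: (block_pos_locate_uniq (xchooseP (block_pos_locate _))).
  by rewrite block_posS; lia.
by congr nth; lia.
Qed.

Variables (t : int) (x : bseq A).
Hypothesis xw : forall i, window x (t + block_pos w i)%R (size (w i)) = w i.

Lemma glued_flatten i m :
  window x (t + block_pos w i)%R (size (flatten (window w i m))) = flatten (window w i m).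
Proof.
elim: m => [|m IH] //.
rewrite -addn1 window_add flatten_cat size_cat window_add IH; congr (_ ++ _).
have -> : flatten (window w (i + m)%R 1) = w (i + m)%R by rewrite /= cats0 addr0.
by rewrite -[RHS]xw; congr window; have := flatten_window w i m; lia.
Qed.

(** The first block is the one containing position [s]; the [n] blocks after it are nonempty, so
    together they reach past [s + n]. *)
Lemma glued_window (s : int) n : exists i l r,
  flatten (window w i n.+1) = l ++ window x s n ++ r.
Proof.
have [i Hi] := block_pos_locate (s - t)%R.
have H := flatten_window w i n.+1.
have := @block_pos_mono (i + 1)%R (i + n.+1)%R.
move=> Hm.
pose a := (absz (s - t - block_pos w i)%R).
pose b := size (flatten (window w i n.+1)) - (a + n).
exists i, (window x (t + block_pos w i)%R a), (window x (s + n)%R b).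
rewrite -glued_flatten.
have -> : size (flatten (window w i n.+1)) = a + (n + b) by rewrite /a /b; lia.
rewrite !window_add; congr (_ ++ (_ ++ _)); congr window; lia.
Qed.

End Glued.

End Bseq.

(** * Points of the subshift *)

Section Points.

Variables (A : finType) (th : rsubst A).

Lemma X_rs_shift (x : bseq A) (n : int) : X_rs th x -> X_rs th (fun i => x (i + n)%R).
Proof. by move=> Hx i m; rewrite window_shift. Qed.

Hypothesis th_wf : rsubst_wf th.

Lemma X_rs_glued (p : nat) (y x : bseq A) (w : bseq (seq A)) (t : int) :
  X_rs th y -> (forall i, w i \in rs_pow th p (y i)) ->
  (forall i, window x (t + block_pos w i)%R (size (w i)) = w i) ->
  X_rs th x.
Proof.
move=> Hy Hw xw s n.
have w_gt0 i : 0 < size (w i) by apply: (size_iter_rs_set th_wf (Hw i)).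
have [i [l [r E]]] := glued_window w_gt0 xw s n.
apply: (@legal_infix _ _ _ (flatten (window w i n.+1))).
  by apply/infixP; exists l, r.
apply: (legal_image th_wf (p := p) (Hy i n.+1)).
by apply: mem_iter_rs_set_map => j; apply: Hw.
Qed.

Lemma mem_rs_word_letter (a : A) (u v : seq A) :
  v \in rs_word th u -> a \in v -> exists e g, g \in th e /\ a \in g.
Proof.
elim: u v => [|e u IH] v /=; first by rewrite inE => /eqP ->.
move=> /allpairsP [[v1 v2] /= [H1 H2 ->]]; rewrite mem_cat => /orP[av|].
  by exists e, v1.
exact: IH.
Qed.

Hypothesis th_prim : primitive th.

(** A letter [c] that generates [u] occurs in an image of every letter after one common number of
    steps, by primitivity. *)
Lemma legal_spread (u : seq A) : legal th u ->
  exists q, forall b, exists2 w, w \in rs_pow th q b & infix u w.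
Proof.
move=> [c [p [v [Hv uv]]]]; have [q [_ Hq]] := th_prim.
exists (p + q) => b; have [w Hw cw] := Hq c b.
move: Hw; case/path.splitPr: cw => l r Hw.
have [vl Hl] := iter_rs_set_nonempty th_wf p l.
have [vr Hr] := iter_rs_set_nonempty th_wf p r.
exists (vl ++ v ++ vr).
  rewrite /rs_pow iterD; apply/mem_iter_rs_setP; exists (l ++ c :: r) => //.
  by apply: mem_iter_rs_set_cat => //; apply: (@mem_iter_rs_set_cat _ _ _ [:: c]).
by apply: infix_trans uv _; apply/infixP; exists vl, vr.
Qed.

Hypothesis th_compat : compatible th.
Variables (a : A) (u v : seq A).
Hypotheses (u_th : u \in th a) (v_th : v \in th a) (uv : u != v).

Lemma X_rs_nonempty : exists x, X_rs th x.
Proof.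
have [W HW] : exists W, forall n, legal th (W n) /\ n.*2 <= size (W n).
  apply: (choice (fun n w => legal th w /\ n.*2 <= size w)) => n.
  by have [w] := legal_long th_wf th_compat th_prim n.*2 u_th v_th uv; exists w.
(* The words [W n], of length at least [2n], are recentred at their position [n]. The values outside
   the word, given by [absz] or by the default [a], never matter: a fixed window lies inside [W n]
   once [n] is large. *)
have [g Hg] := accumulation (fun n (i : int) => nth a (W n) (absz (i + Posz n)%R)).
exists g => i m; have [n Hn nW] := Hg (absz i + m) (absz i + m).
have [legW sW] := HW n.
apply: legal_infix legW; apply/infixP.
exists (take (absz (i + Posz n)%R) (W n)), (drop (m + absz (i + Posz n)%R) (W n)).
rewrite -drop_drop -[LHS](cat_take_drop (absz (i + Posz n)%R)); congr (_ ++ _).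
rewrite -[LHS](cat_take_drop m); congr (_ ++ _).
apply: (@eq_from_nth _ a) => [|j]; first by rewrite size_takel ?size_window // size_drop; lia.
rewrite size_takel ?size_drop; last by lia.
move=> Hj; rewrite nth_window //.
rewrite nth_take; last by lia.
rewrite nth_drop -nW; last by lia.
by congr nth; lia.
Qed.

(** Replacing each letter of some point by an image that contains [s] gives a point in which every
    block contains [s], and block lengths are bounded. *)
Lemma X_rs_dense (s : seq A) : legal th s ->
  exists D x, X_rs th x /\
    forall i : int, exists2 d, d < D & window x (i + Posz d)%R (size s) = s.
Proof.
move=> /legal_spread [q Hq].
have /fin_all_exists [t Ht] : forall b, exists w, w \in rs_pow th q b /\ infix s w.
  by move=> b; have [w] := Hq b; exists w.
have [z Hz] := X_rs_nonempty.
have w_gt0 i : 0 < size (t (z i)).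
  by have [/(size_iter_rs_set th_wf)] := Ht (z i).
have [x Hx] := glue w_gt0 0%R.
pose L := \max_b size (t b).
(* The block after the one holding [i] starts at most [L] places later, and its copy of [s] begins
   within the next [L] places. *)
exists (L + L), x; split=> [|i].
  by apply: (X_rs_glued (p := q) Hz _ Hx) => i; case: (Ht (z i)).
have [j Hj] := block_pos_locate w_gt0 i.
have [_ /infixP [l [r E]]] := Ht (z (j + 1)%R).
have sj : size (t (z j)) <= L by apply: (leq_bigmax (F := fun b => size (t b))).
have sj' : size (t (z (j + 1)%R)) <= L by apply: (leq_bigmax (F := fun b => size (t b))).
have := Hx (j + 1)%R; move: Hj; rewrite block_posS; set e := block_pos _ j => Hj.
(* The empty [s] is set apart, since then [l] may fill its whole block. *)
have ll : size l < L \/ s = [::].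
  move: sj'; rewrite E !size_cat; case: s {E Hq Ht} => [|b s] /=; first by right.
  by left; lia.
case: ll => [ll|->]; last by exists 0 => //=; have := w_gt0 j; lia.
rewrite E !size_cat !window_add => /eqP.
rewrite eqseq_cat ?size_window // => /andP[_].
rewrite eqseq_cat ?size_window // => /andP[/eqP Es _].
exists (absz (e + Posz (size (t (z j))) + size l - i)%R); first by lia.
by rewrite -[RHS]Es; congr window; lia.
Qed.

(* Two points of [X] that differ only in the image of one letter cannot be
   both periodic with the same period. *)
Lemma marker_exists : exists s r, legal th s /\
  forall (y : bseq A) i, window y i (size s) = s ->
    [/\ y i = a, y (i + Posz r)%R = a & window y (i + Posz r)%R (size s) <> s].
Proof.
apply: NNPP => Hn.
(* If [a] stands at [c] and [c + r] but some [x (c + j)] differs from [x (c + r + j)], the window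
   from [c] to [c + r + j] is a marker. Without markers, two letters [a] at distance [r] thus force
   period [r] to the right of the first. *)
have periodic (x : bseq A) c (r : nat) j : X_rs th x -> 0 < r ->
    x c = a -> x (c + Posz r)%R = a -> x (c + Posz j)%R = x (c + Posz r + Posz j)%R.
  move=> Hx r_gt0 xc xr; apply: NNPP => xj; apply: Hn.
  exists (window x c (r + j).+1), r; split=> [|y i]; first exact: Hx.
  rewrite size_window => /eq_window E; split.
  - by have := E 0; rewrite !addr0 xc => ->.
  - by rewrite E //; lia.
  move=> /eq_window E'; apply: xj; rewrite -E'; last by lia.
  by have := E (r + j); rewrite PoszD !addrA => -> //; lia.
have [[|p] [p_gt0 Hp]] := th_prim; first by [].
have [e [g [eg ag]]] : exists e (g : seq A), g \in th e /\ a \in g.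
  have [w Hw aw] := Hp a a.
  have /flatten_mapP [w' _ Hw'] : w \in rs_set th (rs_pow th p a) by [].
  exact: mem_rs_word_letter Hw' aw.
have [u0 Hu0 [eu0 au0]] : exists2 u0, legal th u0 & e \in u0 /\ a \in u0.
  have [w Hw sw] := legal_long th_wf th_compat th_prim 2 u_th v_th uv.
  case: w Hw sw => [|b1 [|b2 w]] // Hw _.
  have [w1 Hw1 e1] := Hp e b1; have [w2 Hw2 e2] := Hp a b2.
  exists (w1 ++ w2); last by rewrite !mem_cat e1 e2 orbT.
  apply: (@legal_image _ _ th_wf p.+1 ([:: b1] ++ [:: b2])).
    by apply: legal_infix Hw; apply/infixP; exists [::], w.
  exact: mem_iter_rs_set_cat.
have [D [y [Hy dense]]] := X_rs_dense Hu0.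
have find b (i : int) : b \in u0 -> exists2 i' : int, (i <= i')%R & y i' = b.
  move=> bu0; have [d _ Ed] := dense i; exists (i + Posz d + Posz (index b u0))%R; first by lia.
  by rewrite -(@nth_window _ b _ _ (size u0)) ?index_mem // Ed nth_index.
(* Two letters [e] to the left of a letter [a]: their images [g] will fix two occurrences of [a]
   before the place where [u] and [v] are exchanged. *)
have [i1 _ yi1] := find e 0%R eu0.
have [i2 i12 yi2] := find e (i1 + 1)%R eu0.
have [i0 i20 yi0] := find a (i2 + 1)%R au0.
(* Only the image at [i0] depends on [q]. The test for [i0] comes first because [e] and [a] may
   coincide. *)
pose W (q : seq A) (i : int) : seq A :=
  if i == i0 then q else if y i == e then g else head [::] (th (y i)).
have W_th q i : q \in th a -> W q i \in th (y i).
  rewrite /W; case: eqP => [->|_]; first by rewrite yi0.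
  case: eqP => [-> //|_] _.
  by have [+ _] := th_wf (y i); case: (th (y i)) => //= r l _; rewrite inE eqxx.
have W_gt0 q i : q \in th a -> 0 < size (W q i).
  by move=> /W_th H; rewrite (size_rs_len th_compat (H i)) rs_len_gt0.
have W_size i : size (W u i) = size (W v i).
  by rewrite !(size_rs_len th_compat (W_th _ _ _)).
have bp_eq i : block_pos (W u) i = block_pos (W v) i by apply: eq_block_pos.
have X_W q x : q \in th a ->
    (forall i, window x (0 + block_pos (W q) i)%R (size (W q i)) = W q i) ->
    X_rs th x.
  move=> Hq; apply: (X_rs_glued (p := 1) Hy) => i.
  by rewrite rs_pow1 W_th.
have [x1 Hx1] := glue (fun i => W_gt0 u i u_th) 0%R.
have [x2 Hx2] := glue (fun i => W_gt0 v i v_th) 0%R.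
have X1 := X_W _ _ u_th Hx1; have X2 := X_W _ _ v_th Hx2.
pose c1 := (block_pos (W u) i1 + Posz (index a g))%R.
pose c2 := (block_pos (W u) i2 + Posz (index a g))%R.
have mono := block_pos_mono (fun i => W_gt0 u i u_th).
have c12 : (c1 < c2)%R by have := mono i1 i2; rewrite /c1 /c2; lia.
have We q i : (i < i0)%R -> y i = e -> W q i = g.
  by move=> ii0 ye; rewrite /W ye eqxx; case: eqP => [E|//]; lia.
have index_lt : index a g < size g by rewrite index_mem.
have c20 : (c2 < block_pos (W u) i0)%R.
  have := mono (i2 + 1)%R i0; rewrite block_posS (We u i2) //; last by lia.
  by rewrite /c2; lia.
have xa x q i : (forall i, window x (0 + block_pos (W q) i)%R (size (W q i)) = W q i) ->
    (i < i0)%R -> y i = e -> x (block_pos (W q) i + Posz (index a g))%R = a.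
  move=> H ii0 yi; have := H i; rewrite We // add0r => E.
  by rewrite -(nth_window a x _ index_lt) E nth_index.
have agree (s : int) : (s < block_pos (W u) i0)%R -> x1 s = x2 s.
  move=> si0; have [i Hi] := block_pos_locate (fun i => W_gt0 u i u_th) s.
  have ii0 : (i < i0)%R.
    by case: (ltP i i0) => // i0i; have := mono i0 i i0i; lia.
  have E : W u i = W v i by rewrite /W; case: eqP => // ?; lia.
  have /eq_window H : window x1 (0 + block_pos (W u) i)%R (size (W u i)) =
                      window x2 (0 + block_pos (W u) i)%R (size (W u i)).
    by rewrite Hx1 bp_eq W_size Hx2.
  have -> : s = (0 + block_pos (W u) i + Posz (absz (s - block_pos (W u) i)%R))%R by lia.
  by apply: H; move: Hi; rewrite block_posS; lia.
pose r := absz (c2 - c1)%R.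
have r_gt0 : 0 < r by rewrite /r; lia.
have c2E : c2 = (c1 + Posz r)%R by rewrite /r; lia.
(* The points [x1] and [x2] agree before the image of [y i0], hence on the first period [[c1, c2)].
   Both have period [r] from [c1] on, so they agree there throughout, although one shows [u] and the
   other [v] at [i0]. *)
have same n : x1 (c1 + Posz n)%R = x2 (c1 + Posz n)%R.
  elim/ltn_ind: n => n IH; case: (ltnP n r) => nr; first by apply: agree; lia.
  have E : (c1 + Posz n = c1 + Posz r + Posz (n - r))%R by lia.
  have i10 : (i1 < i0)%R by lia.
  have i20' : (i2 < i0)%R by lia.
  have x1c1 : x1 c1 = a by rewrite /c1 xa.
  have x1c2 : x1 (c1 + Posz r)%R = a by rewrite -c2E /c2 xa.
  have x2c1 : x2 c1 = a by rewrite /c1 bp_eq xa.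
  have x2c2 : x2 (c1 + Posz r)%R = a by rewrite -c2E /c2 bp_eq xa.
  have nr' : n - r < n by lia.
  by rewrite E -(periodic x1 c1 r) // -(periodic x2 c1 r) // IH.
have := Hx1 i0; have := Hx2 i0; rewrite W_size -bp_eq.
have -> : window x2 (0 + block_pos (W u) i0)%R (size (W v i0)) =
          window x1 (0 + block_pos (W u) i0)%R (size (W v i0)).
  apply/eq_window => j _.
  have -> : (0 + block_pos (W u) i0 + Posz j =
            c1 + Posz (absz (block_pos (W u) i0 + Posz j - c1)%R))%R.
    by lia.
  by rewrite same.
by move=> ->; rewrite /W eqxx => E; move: uv; rewrite E eqxx.
Qed.

End Points.

(** * Desubstitution *)

Section Desubstitution.

Variables (A : finType) (th : rsubst A).
Implicit Types (x y : bseq A) (w : bseq (seq A)) (t n i : int).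

(** By compatibility the block positions do not depend on the images chosen, so the first listed
    images stand for all. *)
Definition start y : int -> int := block_pos (fun i => head [::] (th (y i))).

Definition block x y t i : seq A := window x (t + start y i)%R (rs_len th (y i)).

(* [x] is the concatenation of images of the letters of [y], the image of [y 0]
   starting at [t]; unlike in [recognisable], [t] is arbitrary, so that the pairs
   [(y, t)] attached to [x] form an orbit under reindexing. *)
Definition desub x y t : Prop := X_rs th y /\ forall i, block x y t i \in th (y i).

Lemma start0 y : start y 0 = 0%R.
Proof. exact: block_pos0. Qed.

Lemma startS y i : start y (i + 1)%R = (start y i + Posz (rs_len th (y i)))%R.
Proof. exact: block_posS. Qed.

Lemma start1 y : start y 1 = Posz (rs_len th (y 0%R)).
Proof. by rewrite -[1%R]add0r startS start0 add0r. Qed.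

Lemma start_shift y n i :
  start (fun i => y (i + n)%R) i = (start y (i + n) - start y n)%R.
Proof. exact: (block_pos_shift (fun i => head [::] (th (y i)))). Qed.

(** The range is asymmetric because the start of block [m + 1] is the end of block [m], still
    determined by letters of index at most [m]. *)
Lemma eq_start (m : nat) y y' i : agree_on m y y' ->
  (- Posz m <= i <= Posz m + 1)%R -> start y i = start y' i.
Proof.
move=> E; suff H (k : nat) : (k <= m.+1 -> start y k = start y' k) /\
    (k <= m -> start y (- Posz k)%R = start y' (- Posz k)%R).
  case: i => k Hk; first by apply: (H k).1; lia.
  by rewrite NegzE; apply: (H k.+1).2; move: Hk; rewrite NegzE; lia.
elim: k => [|k [IH1 IH2]]; first by rewrite oppr0 !start0.
split=> km.
  by rewrite -addn1 PoszD !startS IH1 ?E //; lia.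
have := startS y (- Posz k.+1)%R; have := startS y' (- Posz k.+1)%R.
have -> : (- Posz k.+1 + 1 = - Posz k)%R by lia.
by rewrite IH2 ?E //; lia.
Qed.

Lemma desub_reindex x y t n : desub x y t ->
  desub x (fun i => y (i + n)%R) (t + start y n)%R /\
  forall i, block x (fun i => y (i + n)%R) (t + start y n)%R i = block x y t (i + n)%R.
Proof.
move=> [Hy Hx].
have E i : block x (fun i => y (i + n)%R) (t + start y n)%R i = block x y t (i + n)%R.
  by rewrite /block start_shift; congr window; lia.
by split=> //; split=> [|i]; [apply: X_rs_shift | rewrite E].
Qed.

Lemma block_shift x y t i : block (shift x) y (t - 1)%R i = block x y t i.
Proof. by rewrite /block [shift x]/shift window_shift; congr window; lia. Qed.

Lemma desub_shift x y t : desub x y t -> desub (shift x) y (t - 1)%R.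
Proof. by move=> [Hy Hx]; split=> // i; rewrite block_shift. Qed.

Hypothesis th_wf : rsubst_wf th.
Hypothesis th_compat : compatible th.

Let head_gt0 y i : 0 < size (head [::] (th (y i))).
Proof. exact: (rs_len_gt0 th_wf). Qed.

Lemma start_mono y i j : (i <= j)%R -> (start y i + (j - i) <= start y j)%R.
Proof. exact: (block_pos_mono (head_gt0 y)). Qed.

Lemma start_locate y (s : int) : exists i, (start y i <= s < start y (i + 1))%R.
Proof. exact: (block_pos_locate (head_gt0 y)). Qed.

Lemma block_pos_start y w i : (forall i, w i \in th (y i)) -> block_pos w i = start y i.
Proof. by move=> Hw; apply: eq_block_pos => j; rewrite (size_rs_len th_compat (Hw j)). Qed.

Lemma desub_glue y w t : X_rs th y -> (forall i, w i \in th (y i)) ->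
  exists2 x, desub x y t & block x y t = w.
Proof.
move=> Hy Hw; have sw i := size_rs_len th_compat (Hw i).
have w_gt0 i : 0 < size (w i) by rewrite sw rs_len_gt0.
have [x Hx] := glue w_gt0 t.
have E i : block x y t i = w i by rewrite /block -sw -(block_pos_start _ Hw).
exists x; last exact: functional_extensionality.
by split=> // i; rewrite E.
Qed.

Lemma desub_X_rs x y t : desub x y t -> X_rs th x.
Proof.
move=> [Hy Hx]; apply: (X_rs_glued th_wf (p := 1) (t := t) Hy (w := block x y t)) => i.
  by rewrite rs_pow1.
by rewrite size_window (block_pos_start _ Hx).
Qed.

(** The blocks of index in [[-m, m]] tile an interval, the same for both points. Continuity uses
    both directions, passing from letters to blocks and back. *)
Lemma blocks_agree (m : nat) x x' y y' t :
  agree_on m y y' ->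
  (forall i, (`|i| <= m)%N -> block x y t i = block x' y' t i) <->
  (forall s : int, (t + start y (- Posz m) <= s < t + start y (Posz m + 1))%R -> x s = x' s).
Proof.
move=> E; have yy' i : absz i <= m -> y i = y' i by apply: E.
have ss' i : absz i <= m -> start y i = start y' i by move=> im; apply: (eq_start E); lia.
split=> [H s Hs|H i im].
  have [i Hi] := start_locate y (s - t)%R.
  have im : absz i <= m.
    case: (ltP i (- Posz m)%R) => [im|im1].
      by have := @start_mono y (i + 1)%R (- Posz m)%R; lia.
    case: (ltP (Posz m) i) => [im|]; last by lia.
    by have := @start_mono y (Posz m + 1)%R i; lia.
  have := H i im; rewrite /block -yy' // -ss' // => /eq_window /(_ (absz (s - t - start y i)%R)).
  have -> : (t + start y i + Posz (absz (s - t - start y i)%R) = s)%R by lia.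
  by apply; move: Hi; rewrite startS; lia.
rewrite /block -yy' // -ss' //; apply/eq_window => j jl; apply: H.
have := @start_mono y (- Posz m)%R i; have := @start_mono y (i + 1)%R (Posz m + 1)%R.
by rewrite startS; lia.
Qed.

Lemma desub_inj x x' y t : block x y t = block x' y t -> x = x'.
Proof.
move=> E; apply: functional_extensionality => s.
pose m := absz (s - t)%R.
apply: ((blocks_agree (m := m) x x' t (fun i _ => erefl (y i))).1 _ s); first by rewrite E.
have := @start_mono y (- Posz m)%R 0%R; have := @start_mono y 0%R (Posz m + 1)%R.
by rewrite start0 /m; lia.
Qed.

Lemma in_rs_seqE x y (k : nat) :
  in_rs_seq th y (shift_back k x) <-> forall i, block x y (- Posz k)%R i \in th (y i).
Proof.
split=> [[w [Hw H]] i|Hx].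
  suff -> : block x y (- Posz k)%R i = w i by [].
  rewrite /block -(size_rs_len th_compat (Hw i)).
  apply: (@eq_from_nth _ (x 0%R)) => [|j]; rewrite size_window // => jw.
  rewrite nth_window // (set_nth_default (shift_back k x 0%R)) // -H //.
  by rewrite (block_pos_start _ Hw) /shift_back; congr x; lia.
exists (block x y (- Posz k)%R); split=> // i j; rewrite size_window => jl.
by rewrite nth_window // (block_pos_start _ Hx) /shift_back; congr x; lia.
Qed.

(** Block 0 covers position 0. This singles out of each reindexing orbit the pair that
    [recognisable] speaks of, with [k = -t]. *)
Definition normal y t : Prop := (t <= 0 < t + start y 1)%R.

Hypothesis th_rec : recognisable th.

Lemma normal_desub x : X_rs th x -> exists y t, desub x y t /\ normal y t.
Proof.
move=> /th_rec [y [k [[Hy kl /in_rs_seqE Hx] _]]].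
exists y, (- Posz k)%R; split=> //; rewrite /normal start1.
by have := rs_len_gt0 th_wf (y 0%R); lia.
Qed.

Lemma normal_desub_uniq x y t y' t' :
  desub x y t -> normal y t -> desub x y' t' -> normal y' t' -> y' = y /\ t' = t.
Proof.
move=> H; have /th_rec [z [k [_ U]]] := desub_X_rs H.
suff {H} K y1 t1 : desub x y1 t1 -> normal y1 t1 -> y1 = z /\ t1 = (- Posz k)%R.
  by move: H => /K H /H [-> ->] /K H' /H' [-> ->].
move=> [Hy1 Hx]; rewrite /normal start1 => Ht.
have E : t1 = (- Posz (absz t1))%R by lia.
have [|Ey <-] := U y1 (absz t1).
  by split=> //; [lia | apply/in_rs_seqE; rewrite -E].
by split=> //; apply: functional_extensionality.
Qed.

(** Any pair can be reindexed so that block 0 covers the origin; recognisability identifies the two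
    normal pairs, and the two reindexings are then composed. *)
Lemma desub_uniq x y t y' t' : desub x y t -> desub x y' t' ->
  exists n, y' = (fun i => y (i + n)%R) /\ t' = (t + start y n)%R.
Proof.
move=> H H'.
have normalise y1 t1 : desub x y1 t1 -> exists n,
    desub x (fun i => y1 (i + n)%R) (t1 + start y1 n)%R /\
    normal (fun i => y1 (i + n)%R) (t1 + start y1 n)%R.
  move=> H1; have [n Hn] := start_locate y1 (- t1)%R.
  exists n; split; first by case: (desub_reindex n H1).
  by rewrite /normal start_shift (_ : 1 + n = n + 1)%R; lia.
have [n [Hn Nn]] := normalise _ _ H; have [n' [Hn' Nn']] := normalise _ _ H'.
have [Ey Et] := normal_desub_uniq Hn Nn Hn' Nn'.
have Ey' : y' = (fun i => y (i + (n - n'))%R).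
  apply: functional_extensionality => i; have := congr1 (fun z => z (i - n')%R) Ey.
  by rewrite /= subrK => ->; congr y; lia.
exists (n - n')%R; split; first by [].
move: Et; rewrite Ey' start_shift.
by rewrite (_ : n' + (n - n') = n)%R; lia.
Qed.

(** A compactness argument: if it failed, points tending to [x] would have normal desubstitutions
    that stay away from that of [x]. An accumulation point of these is again a normal desubstitution
    of [x], against uniqueness. *)
Lemma normal_desub_continuous x y t (n : nat) : desub x y t -> normal y t ->
  exists m : nat, forall x', X_rs th x' -> agree_on m x x' ->
    exists2 y', desub x' y' t &
      agree_on n y y' /\ forall i, (`|i| <= n)%N -> block x y t i = block x' y' t i.
Proof.
move=> Hx Nx.
(* Once [y] and [y'] agree, equality of the blocks only asks that [x] and [x'] agree on the interval
   they tile, which [B] bounds. *)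
suff [m Hm] : exists m : nat, forall x', X_rs th x' -> agree_on m x x' ->
    exists2 y', desub x' y' t & agree_on n y y'.
  pose B := absz (t + start y (- Posz n))%R + absz (t + start y (Posz n + 1))%R.
  exists (m + B) => x' Hx' E; have [|y' Hy' Ey'] := Hm x' Hx'.
    by move=> i im; apply: E; lia.
  exists y' => //; split=> //; apply/(blocks_agree _ _ _ Ey') => s Hs.
  by apply: E; rewrite /B; lia.
apply: NNPP => Hn.
have /choice [f Hf] : forall m : nat, exists p : bseq A * bseq A * int,
    [/\ agree_on m x p.1.1, desub p.1.1 p.1.2 p.2, normal p.1.2 p.2 &
        ~ (p.2 = t /\ agree_on n y p.1.2)].
  move=> m; apply: NNPP => H; apply: Hn; exists m => x' Hx' E.
  have [y' [t' [Hy' Ny']]] := normal_desub Hx'.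
  apply: NNPP => H'; apply: H; exists (x', y', t'); split=> //= -[Et Ey].
  by apply: H'; exists y'; rewrite // -Et.
pose K := \max_b rs_len th b.
(* A normal offset lies between [-K] and 0, so [absz] of it fits in a finite type and can accumulate
   jointly with the letters. *)
have [g Hg] := accumulation (fun m i => ((f m).1.2 i, inord (absz (f m).2) : 'I_K.+1)).
pose ys i := (g i).1; pose ts := (- Posz (nat_of_ord (g 0%R).2))%R.
have near l N : exists2 m : nat, N <= m & (f m).2 = ts /\ agree_on l (f m).1.2 ys.
  have [m Nm E] := Hg l N; exists m => //; split; last by move=> i /E; rewrite /ys => <-.
  have [_ _ Nf _] := Hf m; rewrite /ts -(E 0%R) //= inordK; first by move: Nf; rewrite /normal; lia.
  move: Nf; rewrite /normal start1.
  by have : rs_len th ((f m).1.2 0%R) <= K := leq_bigmax _; lia.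
have Hys : desub x ys ts.
  split=> i.
    move=> m; have [q _ [_ E]] := near (absz i + m) 0.
    have [_ [Hq _] _ _] := Hf q.
    suff <- : window (f q).1.2 i m = window ys i m by apply: Hq.
    by apply/eq_window => j jm; apply: E; lia.
  have [m Nm [Et E]] := near (absz i) (absz (ts + start ys i)%R + rs_len th (ys i)).
  have [Ex [_ Hy] _ _] := Hf m.
  move: (Hy i); rewrite /block Et (E i) // (eq_start E); last by lia.
  suff <- : window x (ts + start ys i)%R (rs_len th (ys i)) =
            window (f m).1.1 (ts + start ys i)%R (rs_len th (ys i)) by [].
  by apply/eq_window => j jl; apply: Ex; lia.
have Nys : normal ys ts.
  have [m _ [Et E]] := near 0 0; have [_ _ + _] := Hf m.
  by rewrite /normal Et (eq_start E).
have [Ey Et] := normal_desub_uniq Hx Nx Hys Nys.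
have [m _ [Et' E]] := near n 0; have [_ _ _] := Hf m; apply; rewrite -Et -Ey.
by split=> // i im; rewrite E.
Qed.

End Desubstitution.

(** * Conveyor belts *)

Section Belt.

Variables (D : nat) (C : int -> bool).
Implicit Types (i j n : int) (b : bool) (s : int * bool).

Definition dir b (d : nat) : int := if b then Posz d else (- Posz d)%R.

(* The ports [(i, true)] and [(i, false)] are the right and left ends of the cell
   [i]. Facing ports of neighbouring cells are linked; at the end of a run of
   cells a port is linked to itself, which is where the belt turns around. *)
Definition link s : int * bool :=
  let d := find (fun d => C (s.1 + dir s.2 d.+1)%R) (iota 0 D) in
  if C s.1 && (d < D) then ((s.1 + dir s.2 d.+1)%R, ~~ s.2) else s.

Definition flip s : int * bool := (s.1, ~~ s.2).

(* The state [(i, false)] lies on the top track of the cell [i], which moves to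
   the right, and [(i, true)] on its bottom track, which moves to the left. *)
Definition advance s := link (flip s).
Definition retreat s := flip (link s).

Definition walk s n : int * bool :=
  match n with Posz k => iter k advance s | Negz k => iter k.+1 retreat s end.

Lemma link_to i b (d : nat) : C i -> d < D -> C (i + dir b d.+1)%R ->
  (forall d', d' < d -> ~~ C (i + dir b d'.+1)%R) ->
  link (i, b) = ((i + dir b d.+1)%R, ~~ b).
Proof.
move=> Ci dD Cd min; rewrite /link Ci /=.
suff -> : find (fun d => C (i + dir b d.+1)%R) (iota 0 D) = d by rewrite dD.
have -> : D = d + (D - d).-1.+1 by lia.
rewrite iotaD find_cat size_iota /= add0n Cd addn0 ifN //.
by apply/hasPn => d'; rewrite mem_iota => /andP[_]; apply: min.
Qed.

Variant link_spec i b : int * bool -> Type :=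
  | LinkTo d of C i & d < D & C (i + dir b d.+1)%R &
      (forall d', d' < d -> ~~ C (i + dir b d'.+1)%R) :
      link_spec i b ((i + dir b d.+1)%R, ~~ b)
  | LinkSelf : link_spec i b (i, b).

Lemma linkP i b : link_spec i b (link (i, b)).
Proof.
rewrite /link /=; set d := find _ _; have [/andP[Ci dD]|_] := ifP; last exact: LinkSelf.
have dD' : d < size (iota 0 D) by rewrite size_iota.
apply: LinkTo => //.
  by have := dD'; rewrite -has_find => /(nth_find 0); rewrite nth_iota.
move=> d' dd'; have := before_find 0 dd'; rewrite nth_iota ?add0n => [->//|].
exact: ltn_trans dd' dD.
Qed.

(** No cell lies strictly between a cell and its nearest neighbour on one side, so looking back from
    the neighbour finds the first cell again. Hence [advance] is a product of two involutions, and
    [walk] can use its negative powers. *)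
Lemma linkK : involutive link.
Proof.
move=> [i b]; case E: (link (i, b)) / (linkP i b) => [d Ci dD Cd min|//].
have back : (i + dir b d.+1 + dir (~~ b) d.+1 = i)%R by case: b {E Cd min} => /=; lia.
rewrite (@link_to _ _ d) ?back ?negbK // => d' dd'.
have -> : (i + dir b d.+1 + dir (~~ b) d'.+1 = i + dir b (d - d'.+1).+1)%R.
  by case: b {E Cd min back} => /=; lia.
by apply: min; lia.
Qed.

Lemma flipK : involutive flip.
Proof. by case=> i b; rewrite /flip /= negbK. Qed.

Lemma advanceK : cancel advance retreat.
Proof. by move=> s; rewrite /advance /retreat linkK flipK. Qed.

Lemma retreatK : cancel retreat advance.
Proof. by move=> s; rewrite /advance /retreat flipK linkK. Qed.

Lemma walkS s n : walk s (n + 1)%R = advance (walk s n).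
Proof.
case: n => n; first by rewrite -PoszD addn1.
case: n => [|n]; first by rewrite /= retreatK.
have -> : (Negz n.+1 + 1 = Negz n)%R by lia.
by rewrite /walk [in RHS]iterS retreatK.
Qed.

Lemma walk_walk s m n : walk (walk s m) n = walk s (m + n)%R.
Proof.
elim/int_ind_shift: n => [|n]; first by rewrite addr0.
rewrite addrA !walkS; split=> [->//|]; exact: can_inj advanceK _ _.
Qed.

Lemma C_link s : C (link s).1 = C s.1.
Proof. by case: s => i b; case: linkP => //= d -> _ ->. Qed.

Lemma C_walk s n : C (walk s n).1 = C s.1.
Proof.
elim/int_ind_shift: n => [//|n].
by rewrite walkS /advance C_link.
Qed.

Lemma link_near s : (`|((link s).1 - s.1)%R| <= D)%N.
Proof. by case: s => i b; case: linkP => [d _ dD _ _|]; case: b => /=; lia. Qed.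

Lemma walk_near s n : (`|((walk s n).1 - s.1)%R| <= D * `|n|)%N.
Proof.
have iter_near (f : int * bool -> int * bool) k : (forall s, absz ((f s).1 - s.1)%R <= D) ->
    absz ((iter k f s).1 - s.1)%R <= D * k.
  move=> Hf; elim: k => [|k IH]; first by rewrite subrr.
  by rewrite iterS mulnS; have := Hf (iter k f s); lia.
case: n => k /=; first by apply: iter_near => t; apply: link_near.
by apply: (iter_near retreat k.+1) => t; apply: link_near.
Qed.

End Belt.

Lemma link_shift D (C : int -> bool) (n : int) s :
  link D C ((s.1 + n)%R, s.2) = let t := link D (fun i => C (i + n)%R) s in ((t.1 + n)%R, t.2).
Proof.
case: s => i b; rewrite /link /=.
have E d : (i + n + dir b d = i + dir b d + n)%R by lia.
rewrite (eq_find (a2 := fun d => C (i + dir b d.+1 + n)%R)) => [|d]; last by rewrite E.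
by case: ifP => //=; rewrite E.
Qed.

Lemma walk_shift D (C : int -> bool) (n : int) s m :
  walk D C ((s.1 + n)%R, s.2) m =
  let t := walk D (fun i => C (i + n)%R) s m in ((t.1 + n)%R, t.2).
Proof.
have iter_shift (f g : int * bool -> int * bool) k :
    (forall t, f ((t.1 + n)%R, t.2) = ((g t).1 + n, (g t).2)%R) ->
    iter k f ((s.1 + n)%R, s.2) = ((iter k g s).1 + n, (iter k g s).2)%R.
  by move=> H; elim: k => //= k ->; rewrite H.
case: m => k; apply: iter_shift => t.
  by rewrite /advance /flip (link_shift _ _ _ (t.1, ~~ t.2)).
by rewrite /retreat /flip link_shift.
Qed.

Lemma link_local D (C C' : int -> bool) s :
  (forall j : int, (`|(j - s.1)%R| <= D)%N -> C j = C' j) -> link D C s = link D C' s.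
Proof.
case: s => i b /= E; rewrite /link /= E ?subrr //.
have -> // : find (fun d => C (i + dir b d.+1)%R) (iota 0 D) =
             find (fun d => C' (i + dir b d.+1)%R) (iota 0 D).
apply: eq_in_find => d; rewrite mem_iota => /andP[_ dD].
by apply: E; case: b => /=; lia.
Qed.

(** In [k] steps the walk moves at most [D * k] away, and the next link looks at most [D]
    further. *)
Lemma walk_local D (C C' : int -> bool) s (n : int) :
  (forall j : int, (`|(j - s.1)%R| <= D * `|n|.+1)%N -> C j = C' j) ->
  walk D C s n = walk D C' s n.
Proof.
suff H (k : nat) : (forall j : int, (`|(j - s.1)%R| <= D * k.+1)%N -> C j = C' j) ->
    walk D C s (Posz k) = walk D C' s (Posz k) /\
    walk D C s (- Posz k)%R = walk D C' s (- Posz k)%R.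
  case: n => k E; first by apply: (H k _).1.
  by rewrite NegzE; apply: (H k.+1 _).2.
elim: k => [//|k IH] E.
have [IH1 IH2] : walk D C s (Posz k) = walk D C' s (Posz k) /\
    walk D C s (- Posz k)%R = walk D C' s (- Posz k)%R.
  by apply: IH => j jk; apply: E; rewrite mulnS; lia.
split.
  rewrite -addn1 PoszD !walkS -IH1; apply: link_local => j jD; apply: E.
  by have := walk_near D C s (Posz k); rewrite !mulnS; move: jD => /=; lia.
have walkP C1 : walk D C1 s (- Posz k.+1)%R = retreat D C1 (walk D C1 s (- Posz k)%R).
  have -> : (- Posz k = - Posz k.+1 + 1)%R by lia.
  by rewrite walkS advanceK.
rewrite !walkP -IH2 /retreat; congr flip; apply: link_local => j jD; apply: E.
by have := walk_near D C s (- Posz k)%R; rewrite abszN !mulnS; move: jD => /=; lia.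
Qed.

(** With cells in every window of length [D] no chain ever ends, so the walk never turns around: it
    stays on the top track and moves strictly to the right. *)
Lemma walk_top D (C : int -> bool) (c : int) :
  C c -> (forall i : int, exists2 d, d < D & C (i + Posz d)%R) ->
  (forall n, (walk D C (c, false) n).2 = false) /\
  injective (fun n => (walk D C (c, false) n).1).
Proof.
move=> Cc syn.
have step i b : C i -> exists2 d : nat, 0 < d & link D C (i, b) = ((i + dir b d)%R, ~~ b).
  move=> Ci; have ex : exists d, (d < D) && C (i + dir b d.+1)%R.
    case: b; first by have [d dD Cd] := syn (i + 1)%R; exists d; rewrite dD -addrA in Cd *.
    (* To the left, a cell is sought in the window of length [D] that ends just before [i]. *)
    have [d dD Cd] := syn (i - Posz D)%R; exists (D - d.+1).
    rewrite /= (_ : i - Posz (D - d.+1).+1 = i - Posz D + Posz d)%R ?Cd ?andbT; lia.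
  case: (ex_minnP ex) => d /andP[dD Cd] min; exists d.+1 => //.
  apply: link_to => // d' dd'; apply/negP => Cd'.
  by have := min d'; rewrite Cd' andbT; lia.
pose c' n := walk D C (c, false) n.
have top n : (c' n).2 = false.
  elim/int_ind_shift: n => [//|n]; rewrite /c' walkS.
  have := C_walk D C (c, false) n; rewrite [C (c, false).1]Cc.
  case: (walk _ _ _ _) => i [] /= Ci; split=> //.
    by have [d _ E] := step i false Ci; rewrite /advance /flip /= E.
  by have [d _ E] := step i true Ci; rewrite /advance /flip /= E.
split=> //.
have mono n : ((c' n).1 < (c' (n + 1)).1)%R.
  have := C_walk D C (c, false) n; have := top n; rewrite [C (c, false).1]Cc /c' walkS.
  case: (walk _ _ _ _) => i b /= -> Ci; have [d d_gt0 E] := step i true Ci.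
  by rewrite /advance /flip /= E /=; lia.
have mono' n (k : nat) : ((c' n).1 < (c' (n + Posz k.+1)).1)%R.
  elim: k => [|k IH]; first exact: mono.
  by apply: lt_trans IH _; have := mono (n + Posz k.+1)%R; rewrite -addrA -PoszD addn1.
move=> m n /= E; case: (ltrgtP m n) => // mn.
  have := mono' m `|(n - m - 1)%R|%N.
  by rewrite (_ : m + Posz _ = n)%R; [rewrite /c' E ltxx | lia].
have := mono' n `|(m - n - 1)%R|%N.
by rewrite (_ : n + Posz _ = m)%R; [rewrite /c' E ltxx | lia].
Qed.

(** * Automorphisms of the full shift acting on belts *)

Section FullShift.

Variable F : bseq bool -> bseq bool.

Lemma shift_comm_add (F_shift : shift_comm_on full_shift F) z (n i : int) :
  F (fun m => z (m + n)%R) i = F z (i + n)%R.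
Proof.
have E1 z' : F (shift z') = shift (F z').
  by apply: functional_extensionality => j; apply: F_shift.
suff H (k : nat) : forall z i, F (fun m => z (m + Posz k)%R) i = F z (i + Posz k)%R.
  case: n => k; first exact: H.
  have E : (fun m => z (m + Posz k.+1 + Negz k)%R) = z.
    by apply: functional_extensionality => m; congr z; lia.
  have H' : F (fun m => z (m + Posz k.+1 + Negz k)%R) (i + Negz k)%R =
      F (fun m => z (m + Negz k)%R) (i + Negz k + Posz k.+1)%R := H _ _ _.
  by rewrite E in H'; rewrite H'; congr (F _ _); lia.
elim: k => [|k IH] {}z {}i.
  by rewrite addr0; congr (F _ i); apply: functional_extensionality => m; rewrite addr0.
have -> : (fun m => z (m + Posz k.+1)%R) = (fun m => shift z (m + Posz k)%R).
  by apply: functional_extensionality => m; congr z; lia.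
by rewrite IH E1; congr (F z); lia.
Qed.

End FullShift.

Section Action.

Variables (A : eqType) (a : A) (u v s : seq A) (r D : nat).
Implicit Types (y : bseq A) (w : bseq (seq A)) (F G : bseq bool -> bseq bool).
Implicit Types (i n : int) (st : int * bool).

Definition belt_cell y w i : bool :=
  [&& window y i (size s) == s, w i \in [:: u; v] & w (i + Posz r)%R \in [:: u; v]].

Definition slot st : int := if st.2 then (st.1 + Posz r)%R else st.1.

Definition tape y w st : bseq bool := fun n => w (slot (walk D (belt_cell y w) st n)) == v.

(** Each state reads the belt as a binary sequence with itself at the origin and receives coordinate
    0 of the image under [F]. No origin of the belt has to be chosen; for [F] commuting with the
    shift this applies [F] to the belt as a whole. A cyclic belt is read as a periodic sequence. *)
Definition belt_act F y w : bseq (seq A) := fun i =>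
  let write st := if F (tape y w st) 0%R then v else u in
  if belt_cell y w i then write (i, false)
  else if belt_cell y w (i - Posz r)%R then write ((i - Posz r)%R, true) else w i.

Lemma act_shift F y w n i :
  belt_act F (fun i => y (i + n)%R) (fun i => w (i + n)%R) i = belt_act F y w (i + n)%R.
Proof.
have cellE : belt_cell (fun i => y (i + n)%R) (fun i => w (i + n)%R) =
    fun i => belt_cell y w (i + n)%R.
  apply: functional_extensionality => j; rewrite /belt_cell window_shift.
  by rewrite (_ : j + Posz r + n = j + n + Posz r)%R //; lia.
have tapeE st : tape (fun i => y (i + n)%R) (fun i => w (i + n)%R) st =
                tape y w ((st.1 + n)%R, st.2).
  apply: functional_extensionality => m; rewrite /tape walk_shift cellE.
  case: (walk _ _ _ _) => j [] //=.
  by rewrite /slot /= (_ : j + Posz r + n = j + n + Posz r)%R //; lia.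
by rewrite /belt_act !tapeE cellE /= (_ : i - Posz r + n = i + n - Posz r)%R //; lia.
Qed.

(** By continuity of [F], the value at one index depends on finitely many tape entries, which are
    determined by [y] and [w] on a bounded interval. *)
Lemma act_local F y w (n : nat) : cont_on full_shift F ->
  exists K, forall y' w', agree_on K y y' -> agree_on K w w' ->
    agree_on n (belt_act F y w) (belt_act F y' w').
Proof.
move=> F_cont.
have pointwise i : exists K, forall y' w', agree_on K y y' -> agree_on K w w' ->
    belt_act F y w i = belt_act F y' w' i.
  have [m1 Hm1] := F_cont (tape y w (i, false)) I 0.
  have [m2 Hm2] := F_cont (tape y w ((i - Posz r)%R, true)) I 0.
  (* The summands allow for reaching the cell, walking along the belt, deciding whether a position
     is a cell, and passing to the bottom slot. *)
  pose K := absz i + r + D * (m1 + m2).+1 + (r + size s) + r.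
  exists K => y' w' Ey Ew.
  have cellE j : absz j <= absz i + r + D * (m1 + m2).+1 -> belt_cell y w j = belt_cell y' w' j.
    move=> Hj; rewrite /belt_cell (Ew j) ?(Ew (j + Posz r)%R); try by rewrite /K; lia.
    have -> // : window y j (size s) = window y' j (size s).
    by apply/eq_window => k ks; apply: Ey; rewrite /K; lia.
  have tapeE (m : nat) st : (`|st.1| <= absz i + r)%N -> m <= m1 + m2 ->
      agree_on m (tape y w st) (tape y' w' st).
    move=> st_i mm q qm.
    have Dq : D * absz q <= D * (m1 + m2) by rewrite leq_mul2l; apply/orP; right; lia.
    have -> : tape y w st q = (w (slot (walk D (belt_cell y' w') st q)) == v).
      rewrite /tape; congr (w (slot _) == v); apply: walk_local => j Hj.
      apply: cellE; move: Hj Dq; case: st st_i => c b /= ci; rewrite !mulnS.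
      by move: (D * absz q) (D * (m1 + m2)) => p1 p2; lia.
    congr (_ == v); apply: Ew; have := walk_near D (belt_cell y' w') st q.
    by rewrite /K mulnS /slot; case: (walk _ _ _ _) => j [] /=; lia.
  have ri : (`|(i - Posz r)%R| <= absz i + r)%N by lia.
  rewrite /belt_act -!cellE; try by lia.
  rewrite (Hm1 (tape y' w' (i, false)) I _ 0%R) //; last by apply: tapeE => /=; lia.
  rewrite (Hm2 (tape y' w' ((i - Posz r)%R, true)) I _ 0%R) //; last by apply: tapeE => /=; lia.
  by rewrite Ew // /K; lia.
elim: n => [|n [K HK]].
  have [K HK] := pointwise 0%R; exists K => y' w' Ey Ew i.
  by rewrite leqn0 absz_eq0 => /eqP ->; apply: HK.
have [K1 HK1] := pointwise (Posz n.+1); have [K2 HK2] := pointwise (- Posz n.+1)%R.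
exists (K + K1 + K2) => y' w' Ey Ew i.
have sub k : k <= K + K1 + K2 -> agree_on k y y' /\ agree_on k w w'.
  by move=> Hk; split=> j jk; [apply: Ey | apply: Ew]; lia.
have [Ey0 Ew0] := sub K ltac:(lia); have [Ey1 Ew1] := sub K1 ltac:(lia).
have [Ey2 Ew2] := sub K2 ltac:(lia).
rewrite leq_eqVlt => /orP[/eqP iE|]; last exact: HK.
have [->|->] : i = Posz n.+1 \/ i = (- Posz n.+1)%R by lia.
  exact: HK1.
exact: HK2.
Qed.

Hypothesis uv : u != v.
Hypothesis marker : forall y i, window y i (size s) = s ->
  [/\ y i = a, y (i + Posz r)%R = a & window y (i + Posz r)%R (size s) <> s].

(** No index is both the top slot of one cell and the bottom slot of another, so the branches of
    [belt_act] do not compete. *)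
Lemma cellN y w i : belt_cell y w i -> belt_cell y w (i + Posz r)%R = false.
Proof. by case/and3P=> /eqP /marker [_ _ H] _ _; apply/negbTE/negP => /and3P[/eqP]. Qed.

Lemma act_slot F y w st : belt_cell y w st.1 ->
  belt_act F y w (slot st) = if F (tape y w st) 0%R then v else u.
Proof.
case: st => i b /= Ci; rewrite /belt_act /slot; case: b => /=; last by rewrite Ci.
by rewrite cellN // addrK Ci.
Qed.

Lemma act_in F y w i : belt_cell y w i || belt_cell y w (i - Posz r)%R ->
  belt_act F y w i \in [:: u; v].
Proof.
rewrite /belt_act => H; have E b : (if b then v else u) \in [:: u; v].
  by case: b; rewrite !inE eqxx ?orbT.
by case: ifP H => //= _ ->.
Qed.

Lemma act_out F y w i : belt_cell y w i || belt_cell y w (i - Posz r)%R = false ->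
  belt_act F y w i = w i.
Proof. by rewrite /belt_act => /norP[/negbTE -> /negbTE ->]. Qed.

(** Bits stay bits, so cells persist. At an occurrence of [s] at [i] that is not a cell, the marker
    property excludes cells at [i - r] and [i + r]; the images at [i] and [i + r] are then
    untouched, and no cell is created. *)
Lemma cell_act F y w : belt_cell y (belt_act F y w) = belt_cell y w.
Proof.
apply: functional_extensionality => i; have [Ci|] := boolP (belt_cell y w i).
  have [yi _ _] := and3P Ci; rewrite /belt_cell yi /=.
  by rewrite !act_in ?Ci // addrK Ci orbT.
move=> nCi; rewrite /belt_cell; have [/eqP yi /=|//] := boolP (_ == s).
have [_ _ yr] := marker yi.
have C1 : belt_cell y w (i - Posz r)%R = false.
  apply/negP => /and3P[/eqP /marker [_ _]]; rewrite subrK => H.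
  by case: H.
have C2 : belt_cell y w (i + Posz r)%R = false by apply/negP => /and3P[/eqP].
rewrite !act_out ?C1 ?C2 ?addrK ?(negbTE nCi) //.
by apply/negbTE; move: nCi; rewrite /belt_cell yi eqxx.
Qed.

Lemma tape_walk y w st n : tape y w (walk D (belt_cell y w) st n) = fun m => tape y w st (m + n)%R.
Proof.
by apply: functional_extensionality => m; rewrite /tape walk_walk addrC.
Qed.

(** The state reached after [n] steps reads the same tape shifted by [n], so it receives coordinate
    [n] of the image under [F]. *)
Lemma tape_act F y w st : shift_comm_on full_shift F -> belt_cell y w st.1 ->
  tape y (belt_act F y w) st = F (tape y w st).
Proof.
move=> F_shift Cst; apply: functional_extensionality => n.
rewrite {1}/tape cell_act act_slot ?C_walk // tape_walk shift_comm_add // add0r.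
by case: (F _ n); rewrite ?eqxx // (negbTE uv).
Qed.

Lemma act_comp F G y w : shift_comm_on full_shift G ->
  belt_act F y (belt_act G y w) = belt_act (fun z => F (G z)) y w.
Proof.
move=> G_shift; apply: functional_extensionality => i.
rewrite {1 3}/belt_act cell_act; have [Ci|nCi] := boolP (belt_cell y w i).
  by rewrite tape_act.
have [Ci|nCi'] := boolP (belt_cell y w (i - Posz r)%R); first by rewrite tape_act.
by rewrite act_out // (negbTE nCi) (negbTE nCi').
Qed.

Lemma act_id F y w : (forall z, F z = z) -> belt_act F y w = w.
Proof.
move=> F_id; apply: functional_extensionality => i; rewrite /belt_act !F_id.
have E x : x \in [:: u; v] -> (if x == v then v else u) = x.
  by rewrite !inE; case: (eqVneq x v) => [->|_] //; rewrite orbF => /eqP.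
case: ifP => [/and3P[_ + _]|_]; first exact: E.
by case: ifP => [/and3P[_ _]|//]; rewrite /tape /slot /= subrK; apply: E.
Qed.

End Action.

(** * The embedding *)

Section Embedding.

Variables (A : finType) (th : rsubst A).
Hypotheses (th_wf : rsubst_wf th) (th_compat : compatible th) (th_rec : recognisable th).
Variables (a : A) (u v s : seq A) (r D : nat).
Hypotheses (u_th : u \in th a) (v_th : v \in th a) (uv : u != v).
Hypothesis marker : forall (y : bseq A) i, window y i (size s) = s ->
  [/\ y i = a, y (i + Posz r)%R = a & window y (i + Posz r)%R (size s) <> s].
Implicit Types (x y : bseq A) (w : bseq (seq A)) (F G : bseq bool -> bseq bool) (t : int).

Let act := belt_act u v s r D.
Let cell := belt_cell u v s r.

Lemma act_th F y w : (forall i, w i \in th (y i)) -> forall i, act F y w i \in th (y i).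
Proof.
move=> Hw i; rewrite /act /belt_act; have E b : (if b then v else u) \in th a by case: b.
case: ifP => [/and3P[/eqP /marker [-> _ _] _ _]|_]; first exact: E.
case: ifP => [/and3P[/eqP /marker [_ yi _] _ _]|_]; last exact: Hw.
by move: yi; rewrite subrK => ->; apply: E.
Qed.

(** The desubstitution is quantified existentially and the point chosen by [epsilon]. The result
    does not depend on the pair [(y, t)], since any two differ by a reindexing and [belt_act]
    commutes with it. *)
Definition belt_aut F x : bseq A :=
  epsilon (inhabits x) (fun x' => exists y t,
    [/\ desub th x y t, desub th x' y t & block th x' y t = act F y (block th x y t)]).

Lemma belt_autP F x y t : desub th x y t ->
  desub th (belt_aut F x) y t /\ block th (belt_aut F x) y t = act F y (block th x y t).
Proof.
move=> Hx; have [|y' [t' [Hx' HF' E']]] := epsilon_spec (inhabits x) (fun x' => exists y t,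
    [/\ desub th x y t, desub th x' y t & block th x' y t = act F y (block th x y t)]).
  have [x' Hx' E] := desub_glue th_wf th_compat t Hx.1 (act_th F Hx.2).
  by exists x', y, t.
rewrite -/(belt_aut F x) in HF' E'.
have [n [-> ->]] := desub_uniq th_wf th_compat th_rec Hx' Hx.
have [HF EF] := desub_reindex n HF'; have [_ Ex] := desub_reindex n Hx'.
split=> //; apply: functional_extensionality => i; rewrite EF E'.
by rewrite (functional_extensionality _ _ Ex) /act act_shift.
Qed.

Lemma belt_aut_X F : maps_into (X_rs th) (belt_aut F).
Proof.
move=> x Hx; have [y [t [Hy _]]] := normal_desub th_wf th_compat th_rec Hx.
exact: (desub_X_rs th_wf th_compat (belt_autP F Hy).1).
Qed.

Lemma belt_aut_shift F : shift_comm_on (X_rs th) (belt_aut F).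
Proof.
move=> x Hx i; have [y [t [Hy _]]] := normal_desub th_wf th_compat th_rec Hx.
have [H1 E1] := belt_autP F Hy; have [_ E2] := belt_autP F (desub_shift Hy).
suff -> : belt_aut F (shift x) = shift (belt_aut F x) by [].
apply: (desub_inj (th := th) th_wf (y := y) (t := (t - 1)%R)); rewrite E2.
have Eb z : block th (shift z) y (t - 1)%R = block th z y t.
  by apply: functional_extensionality => j; apply: block_shift.
by rewrite !Eb E1.
Qed.

Lemma belt_aut_cont F : cont_on full_shift F -> cont_on (X_rs th) (belt_aut F).
Proof.
move=> F_cont x Hx n; have [y [t [Hy Ny]]] := normal_desub th_wf th_compat th_rec Hx.
(* Blocks are nonempty, so those of index in [[-N, N]] cover [[-n, n]] despite the offset [t]. *)
pose N := n.+1 + absz t.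
have [K HK] := act_local u v s r D y (block th x y t) N F_cont.
have [m Hm] := normal_desub_continuous th_wf th_compat th_rec (N + K) Hy Ny.
exists m => x' Hx' Exx'; have [y' Hy' [Ey Eb]] := Hm x' Hx' Exx'.
have [H1 E1] := belt_autP F Hy; have [H2 E2] := belt_autP F Hy'.
have EyN : agree_on N y y' by move=> i iN; apply: Ey; lia.
move=> i im; apply: (blocks_agree th_wf _ _ t EyN).1 => [j jN|].
  rewrite E1 E2; apply: HK => // k kK; [apply: Ey|apply: Eb]; lia.
have := start_mono th_wf y (i := (- Posz N)%R) (j := 0%R).
have := start_mono th_wf y (i := 0%R) (j := (Posz N + 1)%R).
by rewrite start0 /N; lia.
Qed.

Lemma belt_aut_comp F G x : shift_comm_on full_shift G -> X_rs th x ->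
  belt_aut F (belt_aut G x) = belt_aut (fun z => F (G z)) x.
Proof.
move=> G_shift Hx; have [y [t [Hy _]]] := normal_desub th_wf th_compat th_rec Hx.
have [H1 E1] := belt_autP G Hy; have [H2 E2] := belt_autP F H1.
have [H3 E3] := belt_autP (fun z => F (G z)) Hy.
by apply: (desub_inj th_wf (y := y) (t := t)); rewrite E2 E1 E3; exact: (act_comp D uv marker).
Qed.

Lemma belt_aut_id F x : (forall z, F z = z) -> X_rs th x -> belt_aut F x = x.
Proof.
move=> F_id Hx; have [y [t [Hy _]]] := normal_desub th_wf th_compat th_rec Hx.
have [_ E] := belt_autP F Hy.
by apply: (desub_inj th_wf (y := y) (t := t)); rewrite E; apply: act_id.
Qed.

Lemma belt_aut_is_aut F : is_aut full_shift F -> is_aut (X_rs th) (belt_aut F).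
Proof.
move=> [_ F_cont F_shift [G [_ G_cont GF FG]]].
have GFE z : G (F z) = z by apply: functional_extensionality; apply: GF.
have FGE z : F (G z) = z by apply: functional_extensionality; apply: FG.
have G_shift : shift_comm_on full_shift G.
  move=> z _ i; rewrite -{1}[z]FGE.
  suff <- : F (shift (G z)) = shift (F (G z)) by rewrite GFE.
  by apply: functional_extensionality => j; apply: F_shift.
split; [exact: belt_aut_X | exact: belt_aut_cont | exact: belt_aut_shift |].
exists (belt_aut G); split; [exact: belt_aut_X | exact: belt_aut_cont | |] => x Hx i.
  by rewrite belt_aut_comp // belt_aut_id.
by rewrite belt_aut_comp // belt_aut_id.
Qed.

(** Since occurrences of [s] are syndetic in [y], the top track can be made one bi-infinite line
    carrying any [z]; the image at [c] then reveals [F z 0]. *)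
Lemma belt_aut_inj F G (y : bseq A) :
  X_rs th y -> (forall i : int, exists2 d, d < D & window y (i + Posz d)%R (size s) = s) ->
  shift_comm_on full_shift F -> shift_comm_on full_shift G ->
  eq_on (X_rs th) (belt_aut F) (belt_aut G) -> eq_on full_shift F G.
Proof.
move=> Hy dense F_shift G_shift E z _ i.
suff {i z} H z : F z 0%R = G z 0%R.
  have := H (fun m => z (m + i)%R).
  by rewrite !shift_comm_add // add0r.
pose M i := window y i (size s) == s.
have [d0 _ Mc] := dense 0%R; set c := (0 + Posz d0)%R in Mc.
have [top inj] : (forall n, (walk D M (c, false) n).2 = false) /\
    injective (fun n => (walk D M (c, false) n).1).
  by apply: walk_top => [|i]; [apply/eqP | have [d dD /eqP Hd] := dense i; exists d].
(* The bit to be written at each cell is well defined because the walk visits a position at most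
   once. *)
have [g Hg] : exists g : int -> bool, forall n, g (walk D M (c, false) n).1 = z n.
  have [|g Hg] := choice (fun i b => forall n, (walk D M (c, false) n).1 = i -> b = z n).
    move=> i; have [[n Hn]|Hn] := classic (exists n, (walk D M (c, false) n).1 = i).
      by exists (z n) => m Hm; congr z; apply: inj; rewrite Hn Hm.
    by exists true => n H; case: Hn; exists n.
  by exists g => n; apply: Hg.
(* The bottom track is filled with [u], so every occurrence of [s] becomes a cell. *)
pose w i := if M i then (if g i then v else u)
  else if M (i - Posz r)%R then u else head [::] (th (y i)).
have w_th i : w i \in th (y i).
  rewrite /w; case: ifP => [/eqP /marker [-> _ _]|_]; first by case: ifP.
  case: ifP => [/eqP /marker [_ + _]|_]; first by rewrite subrK => ->.
  by have [+ _] := th_wf (y i); case: (th (y i)) => //= q l _; rewrite inE eqxx.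
have cellE : cell y w = M.
  apply: functional_extensionality => i; rewrite /cell /belt_cell -/(M i).
  have [Mi|//] := boolP (M i).
  have [_ _ /eqP /negbTE Mr] := marker (eqP Mi).
  by rewrite /w Mi addrK Mi -/(M _) in Mr *; rewrite Mr; case: ifP; rewrite !inE !eqxx ?orbT.
have tapeE : tape u v s r D y w (c, false) = z.
  apply: functional_extensionality => n; rewrite /tape -/cell cellE /slot top.
  have := C_walk D M (c, false) n; rewrite [M (c, false).1](introT eqP Mc) /w => ->.
  by rewrite Hg; case: (z n); rewrite ?eqxx // (negbTE uv).
have actE H : act H y w c = if H z 0%R then v else u.
  have Cc : cell y w c by rewrite cellE; apply/eqP.
  by rewrite -tapeE -(act_slot D marker H (st := (c, false)) Cc).
have [x Hx Ex] := desub_glue th_wf th_compat 0%R Hy w_th.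
have [_ EF] := belt_autP F Hx; have [_ EG] := belt_autP G Hx.
have EFG : belt_aut F x = belt_aut G x.
  by apply: functional_extensionality; apply: E; apply: desub_X_rs Hx.
have : act F y w c = act G y w c by rewrite -Ex -EF EFG EG.
rewrite !actE; case: (F z _) (G z _) => [] [] // E'; move: uv; rewrite E' eqxx //.
Qed.

End Embedding.

Theorem theorem4p4 (A : finType) (th : rsubst A) :
  rsubst_wf th -> non_degenerate th -> compatible th -> primitive th ->
  recognisable th ->
  aut_embeds full_shift (X_rs th).
Proof.
move=> th_wf [a size_a] th_compat th_prim th_rec.
have [u [v [u_th v_th uv]]] : exists u v, [/\ u \in th a, v \in th a & u != v].
  move: size_a (undup_uniq (th a)) (mem_undup (th a)).
  case: (undup _) => [|u [|v q]] //= _ /andP[uvq _] H.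
  exists u, v; rewrite -!H !inE !eqxx orbT; split=> //.
  by apply: contraNneq uvq => ->; rewrite inE eqxx.
have [s [r [s_legal marker]]] := marker_exists th_wf th_prim th_compat u_th v_th uv.
have [D [y [Hy dense]]] := X_rs_dense th_wf th_prim th_compat u_th v_th uv s_legal.
exists (belt_aut th u v s r D); split.
- exact: belt_aut_is_aut marker.
- move=> F G _ _ FG x _ i; suff -> : F = G by [].
  by do 2! apply: functional_extensionality => ?; apply: FG.
- by move=> F G _ [_ _ G_shift _] x Hx i; rewrite (belt_aut_comp _ _ _ _ _ _ uv marker).
- move=> F G [_ _ F_shift _] [_ _ G_shift _].
  exact: (belt_aut_inj th_wf th_compat th_rec u_th v_th uv marker Hy dense).
Qed.
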